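(* Let $\kappa$ be an uncountable cardinal with $2^{<\kappa}=\kappa$, and let $X$ be a nonempty regular Hausdorff space of weight at most $\kappa$. For each $1\le\alpha<\kappa^+$ there are ${}^{\kappa}2$-universal sets for both $\kappa^+\text{-}\boldsymbol{\Sigma}^0_\alpha(X)$ and $\kappa^+\text{-}\boldsymbol{\Pi}^0_\alpha(X)$. Therefore there are subsets of ${}^{\kappa}2$ that are $\kappa$-complete for $\kappa^+\text{-}\boldsymbol{\Sigma}^0_\alpha$ and $\kappa^+\text{-}\boldsymbol{\Pi}^0_\alpha$, respectively. In contrast, there is no ${}^{\kappa}2$-universal set for $\kappa^+\text{-}\boldsymbol{\Delta}^0_\alpha({}^{\kappa}2)$ or $\kappa^+\text{-}\mathbf{Bor}({}^{\kappa}2)$. Moreover, if ${}^{\kappa}2$ embeds (topologically) into $X$, then ${}^{\kappa}2$ can be replaced by $X$ throughout: for each $1\le\alpha<\kappa^+$ there are $X$-universal sets for both $\kappa^+\text{-}\boldsymbol{\Sigma}^0_\alpha(X)$ and $\kappa^+\text{-}\boldsymbol{\Pi}^0_\alpha(X)$, there are subsets of $X$ that are $\kappa$-complete for $\kappa^+\text{-}\boldsymbol{\Sigma}^0_\alpha$ and $\kappa^+\text{-}\boldsymbol{\Pi}^0_\alpha$, respectively, and there is no $X$-universal set for $\kappa^+\text{-}\boldsymbol{\Delta}^0_\alpha(X)$ or $\kappa^+\text{-}\mathbf{Bor}(X)$.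
   Context: For a topological space $X$, define by recursion on ordinals $\alpha\ge1$: $\kappa^+\text{-}\boldsymbol{\Sigma}^0_1(X)$ is the family of open sets; for $\alpha>1$, $\kappa^+\text{-}\boldsymbol{\Sigma}^0_\alpha(X)$ is the family of all unions of at most $\kappa$-many sets from $\bigcup_{1\le\beta<\alpha}\kappa^+\text{-}\boldsymbol{\Pi}^0_\beta(X)$; $\kappa^+\text{-}\boldsymbol{\Pi}^0_\alpha(X)$ is the family of complements of sets in $\kappa^+\text{-}\boldsymbol{\Sigma}^0_\alpha(X)$; $\kappa^+\text{-}\boldsymbol{\Delta}^0_\alpha(X)=\kappa^+\text{-}\boldsymbol{\Sigma}^0_\alpha(X)\cap\kappa^+\text{-}\boldsymbol{\Pi}^0_\alpha(X)$. $\kappa^+\text{-}\mathbf{Bor}(X)$ is the smallest family of subsets of $X$ containing the open sets and closed under complements and unions of size at most $\kappa$. Each of these, with $X$ varying over all nonempty topological spaces, is a pointclass $\boldsymbol{\Gamma}$ (assigning to $X$ the family $\boldsymbol{\Gamma}(X)$). The space ${}^{\kappa}2$ carries the bounded topology, generated by the sets $[s]=\{x\in{}^{\kappa}2\mid s\subseteq x\}$ for $s\in{}^{<\kappa}2$. A set $\mathcal{U}\subseteq Y\times X$ is $Y$-universal for $\boldsymbol{\Gamma}(X)$ if $\mathcal{U}\in\boldsymbol{\Gamma}(Y\times X)$ and $\boldsymbol{\Gamma}(X)=\{\mathcal{U}_y\mid y\in Y\}$, where $\mathcal{U}_y=\{x\in X\mid(y,x)\in\mathcal{U}\}$. A set $A\subseteq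 X$ is $\kappa$-complete for $\boldsymbol{\Gamma}$ if $A\in\boldsymbol{\Gamma}(X)$ and for all $B\in\boldsymbol{\Gamma}({}^{\kappa}2)$ there is a continuous $f\colon{}^{\kappa}2\to X$ with $B=f^{-1}(A)$. *)

(* Defs.v *)
From HB Require Import structures.
From mathcomp Require Import all_boot all_order all_classical.
From mathcomp Require Import topology.
From mathcomp Require wochoice.

Set Implicit Arguments.
Unset Strict Implicit.
Unset Printing Implicit Defensive.

Import Order.TTheory.

Local Open Scope classical_set_scope.
Local Open Scope card_scope.

(* An ordinal is given by an element [a] of a well-ordered type, and stands
   for the order type of [seg a].  Every ordinal is of this form, and all the
   notions below depend only on that order type. *)

Definition is_well_order d (O : orderType d) : Prop :=
  wochoice.well_order (<=%O : rel O).

Section Ordinals.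
Context {d : Order.disp_t} {O : orderType d}.
Implicit Types a b : O.

Definition seg a : set O := [set b | (b < a)%O].

Definition ge1 a : Prop := exists b, (b < a)%O.

Definition gt1 a : Prop := exists2 b, ge1 b & (b < a)%O.

Definition is_one a : Prop := ge1 a /\ ~ gt1 a.

(* a < kappa^+, where kappa is the cardinality of K: since kappa^+ is the least
   ordinal of cardinality greater than kappa, this says |a| <= kappa. *)
Definition lt_succ_card (K : Type) a : Prop := seg a #<= [set: K].

End Ordinals.

(* A cardinal kappa is an initial ordinal, here the order type of all of K; the
   elements of K are then the ordinals below kappa. *)
Definition is_cardinal d (K : orderType d) : Prop :=
  is_well_order K /\ forall a : K, ~ ([set: K] #<= seg a).

Section GeneralizedCantor.
Context {d : Order.disp_t} (K : orderType d).

(* The binary sequences of length less than kappa: [existT _ a s] is the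
   sequence s of length a. *)
Definition bseq : Type := {a : K & seg a -> bool}.

(* An alias of K -> bool, because K -> bool itself carries the product topology
   in the library. *)
Definition gcantor : Type := K -> bool.

Definition extends (x : gcantor) (s : bseq) : Prop :=
  forall b : seg (projT1 s), x (val b) = projT2 s b.

Definition cone (s : bseq) : set gcantor := [set x | extends x s].

HB.instance Definition _ := gen_eqMixin gcantor.
HB.instance Definition _ := gen_choiceMixin gcantor.
HB.instance Definition _ :=
  @isSubBaseTopological.Build gcantor (set gcantor) (range cone) id.

End GeneralizedCantor.

(* 2^{<kappa} = kappa, where 2^{<kappa} is the cardinality of the set of binary
   sequences of length less than kappa. *)
Definition pow_lt_eq d (K : orderType d) : Prop := [set: bseq K] #= [set: K].

Definition pointclass := forall X : topologicalType, set (set X).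

Section BorelHierarchy.
Variable K : Type.

(* The recursion on ordinals is written as an inductive family: the index
   strictly decreases, so along a well-order it is the recursively defined
   family; see KSigma_one and KSigma_gt1 for the defining equations. *)
Inductive KSigma_ d (O : orderType d) (X : topologicalType) :
    O -> set X -> Prop :=
| KSigma_open a A : is_one a -> open A -> KSigma_ a A
| KSigma_bigcup a (F : set (set X)) : gt1 a -> F #<= [set: K] ->
    (forall A, F A -> exists b, [/\ ge1 b, (b < a)%O & KPi_ b A]) ->
    KSigma_ a (\bigcup_(A in F) A)
with KPi_ d (O : orderType d) (X : topologicalType) : O -> set X -> Prop :=
| KPi_setC a A : KSigma_ a A -> KPi_ a (~` A).

Definition KSigma d (O : orderType d) (a : O) : pointclass :=
  fun X => [set A | KSigma_ a A].

Definition KPi d (O : orderType d) (a : O) : pointclass :=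
  fun X => [set A | KPi_ a A].

#[local] Arguments KSigma {d O} a X.
#[local] Arguments KPi {d O} a X.

Definition KDelta d (O : orderType d) (a : O) : pointclass :=
  fun X => KSigma a X `&` KPi a X.

Definition KBor : pointclass := fun X =>
  smallest [set S : set (set X) |
      (forall A, S A -> S (~` A)) /\
      (forall F : set (set X), F `<=` S -> F #<= [set: K] ->
         S (\bigcup_(A in F) A))]
    open.

Lemma KSigma_one d (O : orderType d) (a : O) (X : topologicalType) :
  is_one a -> KSigma a X = open.
Proof.
move=> a1; apply/seteqP; split=> A /=; last exact: KSigma_open.
by move=> hA; case: hA a1 => // b F b1 _ _ [].
Qed.

Lemma KSigma_gt1 d (O : orderType d) (a : O) (X : topologicalType) :
  gt1 a -> KSigma a X =
    [set \bigcup_(A in F) A | F in [set F : set (set X) |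
       F #<= [set: K] /\
       F `<=` \bigcup_(b in [set b | ge1 b /\ (b < a)%O]) KPi b X]].
Proof.
move=> a1; apply/seteqP; split=> A /=.
  move=> hA; case: hA a1 => [b B [_ //]|b F _ FK FP b1].
  by exists F => //; split=> // B /FP[c [c1 cb cB]]; exists c.
move=> [F [FK FP] <-]; apply: KSigma_bigcup => // B /FP[b [b1 ba] bB].
by exists b.
Qed.

Lemma KPiE d (O : orderType d) (a : O) (X : topologicalType) :
  KPi a X = [set ~` A | A in KSigma a X].
Proof.
apply/seteqP; split=> A /=; first by case=> b B hB; exists B.
by move=> [B hB <-]; apply: KPi_setC.
Qed.

End BorelHierarchy.

Arguments KSigma K {d O} a X.
Arguments KPi K {d O} a X.
Arguments KDelta K {d O} a X.
Arguments KBor K X : clear implicits.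

Definition is_universal (G : pointclass) (Y X : topologicalType)
    (U : set (Y * X)) : Prop :=
  G (Y * X)%type U /\ G X = range (xsection U).

Definition is_complete d (K : orderType d) (G : pointclass)
    (X : topologicalType) (A : set X) : Prop :=
  G X A /\
  forall B : set (gcantor K), G (gcantor K) B ->
    exists2 f : gcantor K -> X, continuous f & B = f @^-1` A.

Definition weight_le (X : topologicalType) (K : Type) : Prop :=
  exists2 B : set (set X), basis B & B #<= [set: K].

Definition is_embedding (X Y : topologicalType) (f : X -> Y) : Prop :=
  [/\ injective f, continuous f &
      forall U, open U -> exists2 V, open V & f @` U = V `&` range f].

Arguments is_universal G Y X U : clear implicits.
Arguments is_complete {d} K G X A.
Arguments is_embedding X Y f : clear implicits.

(* Main.v *)
Require Import Defs.
From mathcomp Require Import all_boot all_order all_classical.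
From mathcomp Require Import topology finmap.

Set Implicit Arguments.
Unset Strict Implicit.
Unset Printing Implicit Defensive.

Import Order.TTheory.

(** Write kappa for the cardinality of [K] and C for the space [gcantor K].

    Universal sets.  If the space X has a base of at most kappa open sets,
    indexed injectively by [K], a point y of C can be read as the list of those
    basic sets whose index k has y k = true; the pairs (y, x) with x in the
    union of the list form a C-universal open set ([universal_open]).  For
    alpha > 1, a union of at most kappa sets of lower Pi classes is coded by
    the kappa many codes of its members, one for each pair of a level beta and
    an index in [K].  So it is enough to code a kappa-sequence of points of C
    by one point, in such a way that each entry of the sequence depends
    continuously on the code.  The universal set for level alpha is then the
    union, over all such pairs, of continuous preimages of universal sets for
    the lower levels ([universal_KSigma]).  As the position of an entry fixes
    the level of the set that it codes, members of different levels never have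
    to be moved to a common one.

    Continuity of the decoding.  The topology of C is the bounded one, so a
    coordinate change y |-> y \o e is continuous as soon as e maps bounded sets
    to bounded sets.  When kappa is singular, an arbitrary pairing function
    need not have bounded rows.  However 2^{<kappa} = kappa gives an injection
    of K * K into K ([cardinal_pairing]); each of its rows is a subset of K of
    size kappa, hence contains the range of a strictly increasing map of K into
    itself ([increasing_enum]), and such maps preserve boundedness.  These maps
    are the coordinate changes of [exists_slices].

    Complete sets.  C itself has weight at most kappa, because 2^{<kappa} =
    kappa, so it has a universal subset of C * C.  Its preimage under
    z |-> (slice k0 z, slice k1 z) is complete: the section at y is the preimage
    of this set under x |-> the code of (y, x) ([complete_of_universal]).

    Delta and Borel.  These classes are closed under complements and continuous
    preimages, so that the diagonal argument applies ([no_self_universal]).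

    From C to X.  If every open set of the domain of a map is the preimage of
    an open set, then every Sigma or Pi set of the domain is the preimage of a
    set of the same level ([KSigma_trace]).  With an embedding f of C into X, this turns a complete
    subset of C into one of X, and, applied to f * id from C * X to X * X, a
    C-universal set for X into an X-universal one ([universal_embedding]): the
    sections at points outside the range of f do no harm, since the sections of
    a set of a given level are of that level. *)

Local Open Scope classical_set_scope.
Local Open Scope card_scope.

(** * Well-orders *)

Section WellOrder.
Context {d : Order.disp_t} {O : orderType d}.
Hypothesis O_wo : is_well_order O.
Implicit Types (a b : O) (A : set O).

Lemma wo_least A : A !=set0 -> exists2 m, A m & forall x, A x -> (m <= x)%O.
Proof.
case=> x Ax; have [|m [[Am m_lb] _]] := O_wo (A := [pred x | `[< A x >]]).
  by exists x; apply/asboolP.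
exists m => [|y Ay]; first exact/asboolP.
by apply: m_lb; apply/asboolP.
Qed.

Lemma wo_ind (P : O -> Prop) :
  (forall a, (forall b, (b < a)%O -> P b) -> P a) -> forall a, P a.
Proof.
move=> IH a; apply: contrapT => nPa.
have [|m nPm mlb] := wo_least (A := [set b | ~ P b]); first by exists a.
apply: nPm; apply: IH => b bm; apply: contrapT => /mlb.
by rewrite leNgt bm.
Qed.

Lemma wo_wf : well_founded (fun a b : O => (a < b)%O).
Proof. by apply: wo_ind => a IH; constructor. Qed.

Lemma increasing_ge (e : O -> O) :
  {homo e : a b / (a < b)%O} -> forall a, (a <= e a)%O.
Proof.
move=> e_incr; apply: wo_ind => a IH; rewrite leNgt; apply/negP => /[dup] ea.
by move=> /e_incr; apply/negP; rewrite -leNgt IH.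
Qed.

(** The map is built by recursion: [e a] is the least element of [A] not among
    the earlier values, which exist because [A] is too large to be exhausted by
    [a] steps. *)
Lemma increasing_enum A : (forall a, ~ (A #<= seg a)) ->
  exists2 e : O -> O, {homo e : a b / (a < b)%O} & forall a, A (e a).
Proof.
move=> A_big; have [[o _]|O0] := pselect (exists o : O, True); last first.
  by exists id => // a; case: O0; exists a.
pose new (a : O) (rec : forall b, (b < a)%O -> O) : set O :=
  [set x | A x /\ forall b (ba : (b < a)%O), x <> rec b ba].
have /choice[least leastP] : forall B : set O, exists x, B !=set0 ->
    B x /\ forall y, B y -> (x <= y)%O.
  move=> B; have [B0|] := pselect (B !=set0).
    by have [m ? ?] := wo_least B0; exists m.
  by exists o.
pose e := Fix wo_wf (fun=> O) (fun a rec => least (new a rec)).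
have eE a : e a = least (new a (fun b _ => e b)).
  rewrite /e Fix_eq // => x f g fg; congr (least (new _ _)).
  by apply/functional_extensionality_dep => b; apply/funext => bx.
have eP a : new a (fun b _ => e b) (e a) /\
    forall x, new a (fun b _ => e b) x -> (e a <= x)%O.
  rewrite eE; apply: leastP; apply: contrapT => none; apply: (A_big a).
  have sub : A `<=` e @` seg a.
    move=> x Ax; apply: contrapT => xe; apply: none; exists x; split=> // b ba.
    by move=> xeb; apply: xe; exists b.
  exact: card_le_trans (subset_card_le sub) (card_image_le _ _).
exists e => [a b ab|a]; last by have [[]] := eP a.
have [[Aeb eb_new] _] := eP b; have [_ ea_le] := eP a.
rewrite lt_neqAle; apply/andP; split; first by apply/eqP => /esym /(eb_new a ab).
by apply: ea_le; split=> // c ca; apply: eb_new; apply: lt_trans ab.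
Qed.

End WellOrder.

(** * Cardinality *)

Lemma card_leT_inj T U (u0 : U) (A : set T) : A #<= [set: U] ->
  exists f : T -> U, {in A &, injective f}.
Proof.
move=> /card_leP[f].
exists (fun t => if pselect (A t) is left At then
  val (f (SigSub (mem_set At))) else u0) => s t /set_mem As /set_mem At.
case: pselect => // As'; case: pselect => // At' /val_inj.
by move=> /(@inj _ _ _ f) -/(_ (mem_set I) (mem_set I)) [].
Qed.

Lemma inj_card_leT T U (f : T -> U) (A : set T) :
  {in A &, injective f} -> A #<= [set: U].
Proof.
move=> /inj_card_eq; rewrite card_eq_le => /andP[_ Af].
exact: card_le_trans Af (subset_card_le (@subsetT _ _)).
Qed.

Lemma uncountable_point T : ~ countable [set: T] -> exists t : T, True.
Proof.
move=> T_unc; suff [t _] : [set: T] !=set0 by exists t.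
by apply/set0P/eqP => T0; apply: T_unc; rewrite T0.
Qed.

Section Cardinal.
Context {d : Order.disp_t} {K : orderType d}.
Hypotheses (K_card : is_cardinal K) (K_uncountable : ~ countable [set: K]).

(** An infinite cardinal is a limit ordinal: were [m] the last element, moving
    it into the initial segment below it would contradict initiality. *)
Lemma cardinal_no_max (m : K) : exists x, (m < x)%O.
Proof.
apply: contrapT => nx.
have le_m x : (x <= m)%O by rewrite leNgt; apply/negP => mx; apply: nx; exists x.
have segm_inf : infinite_set (seg m).
  move=> segm_fin; apply: K_uncountable; apply: finite_set_countable.
  apply: (@sub_finite_set _ _ (m |` seg m)); last by rewrite finite_setU.
  by move=> x _; have := le_m x; rewrite le_eqVlt => /orP[/eqP|]; [left|right].
have /infiniteP := segm_inf.
move=> /card_leP[nu'].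
pose nu n : K := val (nu' (SigSub (mem_set (I : [set: nat] n)))).
have nu_lt n : (nu n < m)%O.
  by have /set_mem := valP (nu' (SigSub (mem_set (I : [set: nat] n)))).
have nu_inj i j : nu i = nu j -> i = j.
  by move=> /val_inj /(@inj _ _ _ nu') -/(_ (mem_set I) (mem_set I)) [].
pose next x n := x = m /\ n = 0 \/ exists2 i, x = nu i & n = i.+1.
have next_fun x n n' : next x n -> next x n' -> n = n'.
  move=> [[-> ->]|[i -> ->]] [[e ->]|[j e ->]] //.
  - by have := nu_lt j; rewrite -e ltxx.
  - by have := nu_lt i; rewrite e ltxx.
  - by rewrite (nu_inj _ _ e).
have next_inj x x' n : next x n -> next x' n -> x = x'.
  by move=> [[-> ->]|[i -> ->]] [[-> //]|[j -> //] [->]].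
(* As in Hilbert's hotel, m moves to nu 0, each nu i moves to nu i.+1, and
   everything else stays. *)
have /choice[f fP] : forall x, exists y,
    (exists2 n, next x n & y = nu n) \/ (forall n, ~ next x n) /\ y = x.
  move=> x; have [[n xn]|xx] := pselect (exists n, next x n).
    by exists (nu n); left; exists n.
  by exists x; right; split=> // n xn; apply: xx; exists n.
have f_inj : injective f.
  have mixed x y n : (forall n, ~ next y n) -> nu n = y -> next x n -> False.
    by move=> ny nuy _; apply: (ny n.+1); right; exists n.
  move=> x y fxy; have := fP x; rewrite fxy.
  have [[n yn ->]|[ny ->]] := fP y => -[[i xi]|[xx]].
  - by move=> /nu_inj ni; apply: next_inj xi _; rewrite -ni.
  - by move=> xn; case: (mixed _ _ _ xx xn yn).
  - by move=> /esym yi; case: (mixed _ _ _ ny yi xi).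
  - by [].
have f_lt x : (f x < m)%O.
  have [[n _ ->]//|[xx ->]] := fP x; rewrite lt_neqAle le_m andbT.
  by apply/eqP => xm; apply: (xx 0); left.
have [_ /(_ m)] := K_card; apply.
have : f @` setT #= [set: K] by apply: inj_card_eq => x y _ _ /f_inj.
rewrite card_eq_le => /andP[_ /card_le_trans]; apply.
by apply: subset_card_le => _ [x _ <-]; exact: f_lt.
Qed.

(** Since binary sequences of length below kappa are counted by [K], it suffices
    to code a pair by such a sequence. *)
Lemma cardinal_pairing : [set: Defs.bseq K] #<= [set: K] -> 
  exists p : K -> K -> K, forall i j i' j', p i j = p i' j' -> i = i' /\ j = j'.
Proof.
move=> K_pow; have [k0 _] := uncountable_point K_uncountable.
have [q q_inj] := card_leT_inj k0 K_pow.
have /choice[succ lt_succ] := cardinal_no_max.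
(* The code of (i, j) is the indicator of the unordered pair; its length, the
   first or second successor of the maximum, tells whether i <= j. *)
pose len i j := if (i <= j)%O then succ j else succ (succ i).
pose code i j : Defs.bseq K :=
  existT _ (len i j) (fun b => (val b == i) || (val b == j)).
pose supp (s : Defs.bseq K) : set K :=
  [set b | exists2 h : seg (projT1 s), val h = b & projT2 s h].
have suppE i j : supp (code i j) = [set i; j].
  have i_len : (i < len i j)%O.
    rewrite /len; case: (leP i j) => [ij|_]; first exact: le_lt_trans ij (lt_succ j).
    exact: lt_trans (lt_succ i) (lt_succ (succ i)).
  have j_len : (j < len i j)%O.
    rewrite /len; case: (leP i j) => [//|ji]; apply: lt_trans ji _.
    exact: lt_trans (lt_succ i) (lt_succ (succ i)).
  apply/seteqP; split=> b /=.
    by move=> [h <- /orP[/eqP|/eqP] ->]; [left|right].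
  move=> [->|->].
    by exists (SigSub (mem_set (i_len : seg (len i j) i))) => //=; rewrite eqxx.
  by exists (SigSub (mem_set (j_len : seg (len i j) j))) => //=; rewrite eqxx orbT.
have codeI i j i' j' : code i j = code i' j' -> i = i' /\ j = j'.
  move=> /[dup] /(congr1 supp); rewrite !suppE => ij_eq /(congr1 (@projT1 _ _)) /=.
  have len_sym : len i j = len j i -> i = j.
    rewrite /len; case: (ltgtP i j) => // _ /eqP; first by rewrite lt_eqF.
    by rewrite gt_eqF.
  have mem_l b : [set i; j] b -> b = i' \/ b = j' by rewrite ij_eq.
  have mem_r b : [set i'; j'] b -> b = i \/ b = j by rewrite -ij_eq.
  have [ii'|ij'] := mem_l i (or_introl erefl).
    rewrite ii'; split=> //; have [ji'|//] := mem_l j (or_intror erefl).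
    by have [->|->] := mem_r j' (or_intror erefl); rewrite // ji' -ii'.
  have [i'i|i'j] := mem_r i' (or_introl erefl).
    rewrite i'i; split=> //; have [->|//] := mem_l j (or_intror erefl).
    by rewrite i'i.
  by rewrite i'j -ij' => /len_sym ->.
exists (fun i j => q (code i j)) => i j i' j' qq.
by apply/codeI/q_inj => //; exact/mem_set.
Qed.

End Cardinal.

(** * The bounded topology *)

Section BoundedTopology.
Context {d : Order.disp_t} {K : orderType d}.
Implicit Types (x y : gcantor K) (a b : K) (A : set (gcantor K)).

Definition agree a x y := forall b, (b < a)%O -> x b = y b.

Lemma agreeW a b x y : (a <= b)%O -> agree b x y -> agree a x y.
Proof. by move=> ab xy c ca; apply: xy; apply: lt_le_trans ab. Qed.

Definition restriction x a : Defs.bseq K := existT _ a (fun h => x (val h)).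

Lemma cone_restriction x a : cone (restriction x a) = [set y | agree a x y].
Proof.
apply/seteqP; split=> y /=.
  by move=> xy b ba; have /= -> := xy (SigSub (mem_set (ba : seg a b))).
by move=> xy h; rewrite /= xy //; have /set_mem := valP h.
Qed.

Lemma cone_bounded x (s : Defs.bseq K) : cone s x -> agree (projT1 s) x `<=` cone s.
Proof.
by move=> xs y xy b; rewrite -xs -xy //; have /set_mem := valP b.
Qed.

Lemma open_cone (s : Defs.bseq K) : open (cone s).
Proof.
exists [set cone s]; last by rewrite bigcup_set1.
by move=> _ ->; apply: (@finI_from1 _ _ _ id); exists s.
Qed.

(** The cones form a base and not merely a subbase, since finitely many bounds
    in [K] have a maximum; [k0] serves as bound for the empty intersection. *)
Lemma gcantor_openP (k0 : K) A :
  open A <-> forall x, A x -> exists a, agree a x `<=` A.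
Proof.
split=> [[D D_fin <-] x [B DB Bx]|A_bdd].
  have [E E_cone EB] := D_fin B DB.
  have Ex C : C \in enum_fset E -> C x.
    by have : B x by []; rewrite -EB => Ex CE; apply: Ex.
  suff [a aE] : exists a, forall C, C \in enum_fset E -> agree a x `<=` C.
    exists a => y xy; exists B => //.
    by suff: B y by []; rewrite -EB => C /aE; apply.
  have : forall C, C \in enum_fset E -> exists b, agree b x `<=` C.
    move=> C CE; have /set_mem[s _ sC] := E_cone _ CE; exists (projT1 s).
    by rewrite -sC; apply: cone_bounded; rewrite sC; exact: Ex.
  elim: (enum_fset E) => [_|C0 l IH Cl]; first by exists k0.
  have [C lC|a aP] := IH; first by apply: Cl; rewrite inE lC orbT.
  have [b bP] := Cl C0 (mem_head _ _).
  exists (Order.max a b) => C; rewrite inE => /orP[/eqP ->|/aP aC] y xy.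
    by apply: bP; apply: agreeW xy; rewrite le_max lexx orbT.
  by apply: aC; apply: agreeW xy; rewrite le_max lexx.
rewrite openE => x /A_bdd[a aA]; rewrite /interior nbhsE.
exists (cone (restriction x a)); last by rewrite cone_restriction.
by split; [exact: open_cone|rewrite cone_restriction].
Qed.

Lemma agree_continuous (k0 : K) (f : gcantor K -> gcantor K) :
  (forall a, exists b, forall x y, agree b x y -> agree a (f x) (f y)) ->
  continuous f.
Proof.
move=> f_unif; apply/continuousP => A /(gcantor_openP k0) A_bdd.
apply/(gcantor_openP k0) => x /A_bdd[a aA]; have [b bP] := f_unif a.
by exists b => y xy; apply: aA; exact: bP.
Qed.

Lemma gcantor_weight (k0 : K) :
  [set: Defs.bseq K] #<= [set: K] -> weight_le (gcantor K) K.
Proof.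
move=> K_pow; exists (range (@cone _ K)).
  split=> [_ [s _ <-]|x A]; first exact: open_cone.
  rewrite nbhsE => -[B [/(gcantor_openP k0) B_bdd /B_bdd[a aB]] BA].
  exists (cone (restriction x a)) => /=.
    by split; [exists (restriction x a)|rewrite cone_restriction].
  by rewrite cone_restriction; apply: subset_trans BA.
exact: card_le_trans (card_image_le _ _) K_pow.
Qed.

End BoundedTopology.

(** A point codes a family of points indexed by [K], [slice i] reading off the
    entry of index [i].  The third clause is a uniform continuity of the coding:
    below [a], the code only depends on the entries below [a]. *)
Lemma exists_slices d (K : orderType d) : is_cardinal K ->
    ~ countable [set: K] -> [set: Defs.bseq K] #<= [set: K] ->
  exists (slice : K -> gcantor K -> gcantor K)
         (join : (K -> gcantor K) -> gcantor K),
    [/\ forall i, continuous (slice i),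
        forall z i, slice i (join z) = z i &
        forall a z z', (forall i, agree a (z i) (z' i)) ->
          agree a (join z) (join z')].
Proof.
move=> K_card K_unc K_pow; have [p p_inj] := cardinal_pairing K_card K_unc K_pow.
have [k0 _] := uncountable_point K_unc.
have [K_wo K_init] := K_card.
have /choice[e eP] : forall i, exists e : K -> K,
    {homo e : a b / (a < b)%O} /\ forall j, range (p i) (e j).
  move=> i; have [a|e ? ?] := increasing_enum K_wo (A := range (p i)).
    move=> pa; apply: (K_init a); apply: card_le_trans pa.
    have : range (p i) #= [set: K] by apply: inj_card_eq => j j' _ _ /p_inj[].
    by rewrite card_eq_le => /andP[].
  by exists e.
have e_inj i j i' j' : e i j = e i' j' -> i = i' /\ j = j'.
  move=> eij; have ii' : i = i'.
    have [_ /(_ j)[k _ pe]] := eP i; have [_ /(_ j')[k' _ pe']] := eP i'.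
    by have [] : i = i' /\ k = k' by apply: p_inj; rewrite pe pe'.
  split=> //; move: eij; rewrite -ii'; have [e_incr _] := eP i.
  by case: (ltgtP j j') => // /e_incr => [lt|lt] eij; move: lt; rewrite eij ltxx.
pose slice i (y : gcantor K) : gcantor K := fun j => y (e i j).
pose join (z : K -> gcantor K) : gcantor K :=
  fun k => `[< exists i j, k = e i j /\ z i j >].
exists slice, join; split=> [i|z i|a z z' zz' b ba].
- apply: (agree_continuous k0) => a; exists (e i a) => x y xy b ba.
  by apply: xy; have [e_incr _] := eP i; apply: e_incr.
- apply/funext => j; apply/asboolP/idP; last by exists i, j.
  by move=> [i' [j' [/e_inj[-> ->]]]].
- have le_b i j : b = e i j -> (j < a)%O.
    move=> be; apply: le_lt_trans ba; rewrite be.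
    by have [/(increasing_ge K_wo) le_e _] := eP i; exact: le_e.
  by apply/asbool_equiv_eq; split=> -[i [j [/[dup] be /le_b ja zij]]];
    exists i, j; split=> //; move: zij; rewrite (zz' i j ja).
Qed.

(** * Closure properties of pointclasses *)

Section Pointclass.
Implicit Types (G : pointclass) (X Y Z W : topologicalType).

Definition preimage_closed G := forall Z W (g : Z -> W) (A : set W),
  continuous g -> G W A -> G Z (g @^-1` A).

Definition complement_closed G := forall Z (A : set Z), G Z A -> G Z (~` A).

(** The domain carries the initial topology of [g], up to the continuity of
    [g]; the topological embeddings are the continuous injective such maps. *)
Definition initial_map Z W (g : Z -> W) :=
  forall A, open A -> exists2 B, open B & A = g @^-1` B.

Definition trace_closed G := forall Z W (g : Z -> W) (A : set Z),
  initial_map g -> G Z A -> exists2 B, G W B & A = g @^-1` B.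

Lemma pair_continuous Z W W' (f : Z -> W) (g : Z -> W') :
  continuous f -> continuous g -> continuous (fun z => (f z, g z)).
Proof.
by move=> f_cont g_cont z; apply: cvg_pair; [exact: f_cont|exact: g_cont].
Qed.

Lemma fst_continuous Z W : continuous (@fst Z W).
Proof. by move=> zw; exact: cvg_fst. Qed.

Lemma snd_continuous Z W : continuous (@snd Z W).
Proof. by move=> zw; exact: cvg_snd. Qed.

Lemma xsection_preimage_closed G Y X y (U : set (Y * X)) : preimage_closed G ->
  G (Y * X)%type U -> G X (xsection U y).
Proof.
move=> G_pre GU; rewrite xsectionE; apply: (G_pre _ _ _ _ _ GU).
by apply: pair_continuous; [exact: cst_continuous|move=> ?; exact: cvg_id].
Qed.

Lemma open_setX Z W (A : set Z) (B : set W) : open A -> open B -> open (A `*` B).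
Proof.
move=> A_open B_open.
apply: openI; [apply: (open_comp (f := fst))|apply: (open_comp (f := snd))] => //.
  by move=> yx _; exact: fst_continuous.
by move=> yx _; exact: snd_continuous.
Qed.

(** Cantor's diagonal argument: the complement of the diagonal of a universal set
    would be one of its sections. *)
Lemma no_self_universal G X : preimage_closed G -> complement_closed G ->
  ~ exists U, is_universal G X X U.
Proof.
move=> G_pre G_compl [U [GU GX]].
have : G X (~` ((fun x => (x, x)) @^-1` U)).
  by apply/G_compl/G_pre => //; apply: pair_continuous; move=> ?; exact: cvg_id.
rewrite GX => -[x _ /seteqP[sub_diag sup_diag]].
have nUxx : ~ U (x, x).
  by move=> /[dup] /xsectionP /sub_diag nUxx /nUxx.
by apply: (nUxx); apply/xsectionP/sup_diag.
Qed.

Lemma universal_setC K d (O : orderType d) (a : O) Y X (U : set (Y * X)) :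
  is_universal (KSigma K a) Y X U -> is_universal (KPi K a) Y X (~` U).
Proof.
move=> [aU univU]; split; first exact: KPi_setC.
have secC y : xsection (~` U) y = ~` xsection U y by rewrite !xsectionE.
rewrite KPiE univU; apply/seteqP; split=> [_ [_ [y _ <-] <-]|_ [y _ <-]].
  by exists y.
by exists (xsection U y) => //; exists y.
Qed.

Section Levels.
Variable K : Type.
Context {d : Order.disp_t} {O : orderType d}.
Hypothesis O_wo : is_well_order O.
Implicit Types a b : O.

Lemma KSigma_preimage a : preimage_closed (KSigma K a).
Proof.
elim/(wo_ind O_wo): a => a IH Z W g A g_cont hA.
case: hA IH => {a A} [a A a1 oA|a F a1 FK FP] IH.
  by apply: KSigma_open => //; move/continuousP: g_cont; apply.
have -> : g @^-1` (\bigcup_(A in F) A) =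
    \bigcup_(B in [set g @^-1` A | A in F]) B.
  by rewrite preimage_bigcup bigcup_image.
apply: KSigma_bigcup => // [|_ [A /FP[b [b1 ba bA]] <-]].
  exact: card_le_trans (card_image_le _ _) FK.
exists b; split=> //; case: bA IH ba {b1} => {A}{}b A bA IH ba.
by rewrite -preimage_setC; apply/KPi_setC/(IH b ba Z W g A).
Qed.

(** Open sets are preimages of open sets by assumption, and forming preimages
    commutes with complements and unions, so witnesses can be chosen level by
    level. *)
Lemma KSigma_trace a : trace_closed (KSigma K a).
Proof.
elim/(wo_ind O_wo): a => a IH Z W g A g_init hA.
case: hA IH => {a A} [a A a1 oA|a F a1 FK FP] IH.
  by have [B oB AB] := g_init A oA; exists B => //; exact: KSigma_open.
have /choice[t tP] : forall A, exists B, F A ->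
    (exists b, [/\ ge1 b, (b < a)%O & KPi_ K b B]) /\ A = g @^-1` B.
  move=> A; have [FA|] := pselect (F A); last by exists set0.
  have [b [b1 ba bA]] := FP A FA.
  case: bA IH ba b1 {FA} => {A}{}b A bA IH ba b1.
  have [B bB ->] := IH b ba Z W g A g_init bA.
  by exists (~` B) => _; split=> //; exists b; split=> //; exact: KPi_setC.
exists (\bigcup_(B in t @` F) B).
  apply: KSigma_bigcup => // [|_ [A /tP[bP _] <-]] //.
  exact: card_le_trans (card_image_le _ _) FK.
rewrite bigcup_image preimage_bigcup.
by apply: eq_bigcupr => A /tP[].
Qed.

Lemma KPi_preimage a : preimage_closed (KPi K a).
Proof.
move=> Z W g A g_cont; rewrite !KPiE => -[B aB <-].
by exists (g @^-1` B) => //; apply: KSigma_preimage.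
Qed.

Lemma KPi_trace a : trace_closed (KPi K a).
Proof.
move=> Z W g A g_init; rewrite !KPiE => -[B aB <-].
have [C aC ->] := KSigma_trace g_init aB.
by exists (~` C) => //; exists C.
Qed.

Lemma KDelta_preimage a : preimage_closed (KDelta K a).
Proof.
move=> Z W g A g_cont [SA PA].
by split; [apply: KSigma_preimage|apply: KPi_preimage].
Qed.

Lemma KDelta_setC a : complement_closed (KDelta K a).
Proof.
move=> Z A [SA]; rewrite KPiE => -[B SB BA]; split; last exact: KPi_setC.
by rewrite -BA setCK.
Qed.

(** The empty set is in every Pi class, because the whole space is open and is
    the union of a single set of the first Pi class, itself. *)
Lemma KPi0 (k0 : K) a (X : topologicalType) : ge1 a -> KPi K a X set0.
Proof.
have Sigma1 b : is_one b -> KSigma K b X set0.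
  by move=> b1; apply: KSigma_open => //; exact: open0.
have Pi1 b : is_one b -> KPi K b X setT.
  by move=> b1; rewrite -setC0; apply: KPi_setC; exact: Sigma1.
move=> a1; rewrite -setCT; apply: KPi_setC.
have [b b1 b_least] := wo_least O_wo (ex_intro _ a a1 : [set b | ge1 b] !=set0).
have one_b : is_one b.
  by split=> // -[c c1 cb]; move: (b_least c c1); rewrite leNgt cb.
have [->|] := eqVneq a b; first by apply: KSigma_open => //; exact: openT.
rewrite eq_sym => ba; have {}ba : (b < a)%O by rewrite lt_neqAle ba b_least.
have -> : [set: X] = \bigcup_(A in [set setT]) A by rewrite bigcup_set1.
apply: KSigma_bigcup; first by exists b.
  by apply: (inj_card_leT (f := fun=> k0)) => A B /set_mem -> /set_mem ->.
by move=> _ ->; exists b; split=> //; exact: Pi1.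
Qed.

End Levels.

Section Borel.
Variable K : Type.

Lemma KBor_open Z (A : set Z) : open A -> KBor K Z A.
Proof. exact: sub_gen_smallest. Qed.

Lemma KBor_setC : complement_closed (KBor K).
Proof.
move=> Z A A_bor S [[SC S_bigcup] S_open].
by apply: (SC); exact: (A_bor S (conj (conj SC S_bigcup) S_open)).
Qed.

Lemma KBor_bigcup Z (F : set (set Z)) : F `<=` KBor K Z -> F #<= [set: K] ->
  KBor K Z (\bigcup_(A in F) A).
Proof.
move=> F_bor FK S [[SC S_bigcup] S_open]; apply: (S_bigcup) => // A /F_bor A_bor.
exact: (A_bor S (conj (conj SC S_bigcup) S_open)).
Qed.

Lemma KBor_preimage : preimage_closed (KBor K).
Proof.
move=> Z W g A g_cont A_bor.
apply: (A_bor [set B | KBor K Z (g @^-1` B)]); split=> [|B B_open]; last first.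
  by apply: KBor_open; move/continuousP: g_cont; apply.
split=> [B|F F_bor FK] /=; first by rewrite preimage_setC; exact: KBor_setC.
rewrite preimage_bigcup -(bigcup_image F (preimage g) id).
apply: KBor_bigcup => [_ [B /F_bor ? <-] //|].
exact: card_le_trans (card_image_le _ _) FK.
Qed.

End Borel.

End Pointclass.

(** * Universal and complete sets *)

Section Universal.
Context {d : Order.disp_t} {K : orderType d}.
Hypotheses (K_card : is_cardinal K) (K_uncountable : ~ countable [set: K])
  (K_pow : [set: Defs.bseq K] #<= [set: K]).
Local Notation C := (gcantor K).

Lemma open_coordinate k : open [set y : C | y k].
Proof.
have [k' kk'] := cardinal_no_max K_card K_uncountable k.
apply/(gcantor_openP k) => y /= yk.
by exists k' => y' yy' /=; rewrite -yy'.
Qed.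

Lemma universal_open (X : topologicalType) : weight_le X K ->
  exists U : set (C * X), open U /\ open = range (xsection U).
Proof.
have [k0 _] := uncountable_point K_uncountable.
move=> [B [B_open B_basis] BK].
have [h h_inj] := card_leT_inj k0 BK.
exists (\bigcup_(A in B) ([set y : C | y (h A)] `*` A)); split.
  apply: bigcup_open => A BA.
  by apply: open_setX; [exact: open_coordinate|exact: B_open].
apply/seteqP; split=> [A A_open|_ [y _ <-]].
  exists (fun k => `[< exists2 D, B D /\ D `<=` A & h D = k >]) => //.
  apply/seteqP; split=> x.
    move=> /xsectionP[D BD [/= /asboolP[D' [BD' D'A] hD] Dx]].
    by apply: D'A; rewrite (h_inj D' D) //; exact/mem_set.
  move=> Ax; have [D [BD Dx] DA] := B_basis x A (open_nbhs_nbhs (conj A_open Ax)).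
  by apply/xsectionP; exists D => //; split=> //=; apply/asboolP; exists D.
rewrite openE => x /xsectionP[D BD [/= yD Dx]].
rewrite /interior nbhsE; exists D; first by split=> //; exact: B_open.
by move=> x' Dx'; apply/xsectionP; exists D.
Qed.

Lemma universal_KSigma d' (O : orderType d') (X : topologicalType) (a : O) :
    is_well_order O -> weight_le X K -> ge1 a -> lt_succ_card K a ->
  exists U, is_universal (KSigma K a) C X U.
Proof.
move=> O_wo X_weight; elim/(wo_ind O_wo): a => a IH a1 aK.
have [a_gt1|a_le1] := pselect (gt1 a); last first.
  have [U [U_open univU]] := universal_open X_weight.
  exists U; rewrite /is_universal !KSigma_one //; exact: conj.
have [k0 _] := uncountable_point K_uncountable.
have [slice [join [slice_continuous joinK _]]] :=
  exists_slices K_card K_uncountable K_pow.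
have [pair pair_inj] := cardinal_pairing K_card K_uncountable K_pow.
have [i i_inj] := card_leT_inj k0 aK.
have /choice[V V_univ] : forall b, exists V, ge1 b -> (b < a)%O ->
    is_universal (KPi K b) C X V.
  move=> b; have [[b1 ba]|nb] := pselect (ge1 b /\ (b < a)%O); last first.
    by exists set0 => b1 ba; case: nb.
  have [|U U_univ] := IH b ba b1.
    apply: card_le_trans aK; apply: subset_card_le => c; rewrite /seg /= => cb.
    exact: lt_trans ba.
  by exists (~` U) => _ _; exact: universal_setC.
(* The entry of a code at index b k describes a member of level b. *)
pose index (b : O) k := pair (i b) k.
have index_inj b k b' k' : (b < a)%O -> (b' < a)%O -> index b k = index b' k' ->
    b = b' /\ k = k'.
  move=> ba b'a /pair_inj[/i_inj ibb' ->]; split=> //.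
  by apply: ibb'; apply/mem_set.
pose piece (bk : O * K) : set (C * X) :=
  [set yx | V bk.1 (slice (index bk.1 bk.2) yx.1, yx.2)].
pose J : set (O * K) := [set bk | ge1 bk.1 /\ (bk.1 < a)%O].
have U_Sigma : KSigma K a (C * X)%type (\bigcup_(A in piece @` J) A).
  apply: KSigma_bigcup => // [|_ [[b k] [b1 ba] <-]].
    apply: card_le_trans (card_image_le _ _) _.
    apply: (inj_card_leT (f := fun bk => index bk.1 bk.2)).
    move=> [b k] [b' k'] /set_mem[_ ba] /set_mem[_ b'a] /index_inj[] //.
    by move=> /= -> ->.
  exists b; split=> //; have [VPi _] := V_univ b b1 ba.
  apply: (KPi_preimage O_wo
      (g := fun yx : C * X => (slice (index b k) yx.1, yx.2)) _ VPi).
  apply: pair_continuous; last exact: snd_continuous.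
  move=> yx; apply: continuous_comp; first exact: fst_continuous.
  exact: slice_continuous.
exists (\bigcup_(A in piece @` J) A); split=> //.
apply/seteqP; split=> [A|_ [y _ <-]]; last first.
  exact: (xsection_preimage_closed y (KSigma_preimage O_wo (a := a)) U_Sigma).
rewrite KSigma_gt1 // => -[F [FK FPi] <-] {A}.
have [h h_inj] := card_leT_inj k0 FK.
(* The member of F coded at index b k, or set0 if there is none. *)
pose target (b : O) k := \bigcup_(A in [set A | F A /\ h A = k /\ KPi K b X A]) A.
have target_Pi b k : ge1 b -> KPi K b X (target b k).
  move=> b1; have [[A [FA [hA bA]]]|nA] :=
      pselect (exists A, F A /\ h A = k /\ KPi K b X A).
    suff -> : target b k = A by [].
    apply/seteqP; split=> [x [A' [FA' [hA' _]] A'x]|x Ax]; last by exists A.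
    by rewrite -(h_inj A' A) ?hA' ?hA //; exact/mem_set.
  suff -> : target b k = set0 by apply: (KPi0 O_wo k0).
  by rewrite -subset0 => x [A PA _]; case: nA; exists A.
have /choice[z zP] : forall j, exists y, forall b k, ge1 b -> (b < a)%O ->
    index b k = j -> xsection (V b) y = target b k.
  move=> j; have [[b [k [b1 ba bkj]]]|nj] :=
      pselect (exists b k, [/\ ge1 b, (b < a)%O & index b k = j]); last first.
    by exists (fun=> false) => b k b1 ba bkj; case: nj; exists b, k.
  have [_ univV] := V_univ b b1 ba.
  have := target_Pi b k b1; rewrite univV => -[y _ yE]; exists y.
  by move=> b' k' _ b'a; rewrite -bkj => /index_inj[] // -> ->.
exists (join z) => //; apply/seteqP; split=> x.
  move=> /xsectionP[_ [[b k] [/= b1 ba] <-]]; rewrite /piece /= joinK => Vx.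
  have : xsection (V b) (z (index b k)) x by exact/xsectionP.
  by rewrite (zP _ b k) // => -[A [FA _] Ax]; exists A.
move=> [A FA Ax]; have [b [b1 ba] bA] := FPi A FA.
apply/xsectionP; exists (piece (b, h A)); first by exists (b, h A).
rewrite /piece /= joinK; apply/xsectionP.
by rewrite (zP _ b (h A)) //; exists A.
Qed.

(** Filling the entry [k0] of a code with y and the others with x gives a point
    at which the two slices are y and x, and which depends continuously on x. *)
Lemma complete_of_universal G : preimage_closed G ->
  (exists U, is_universal G C C U) -> exists A, is_complete K G C A.
Proof.
have [k0 _] := uncountable_point K_uncountable.
have [k1 k01] := cardinal_no_max K_card K_uncountable k0.
have [slice [join [slice_continuous joinK join_agree]]] :=
  exists_slices K_card K_uncountable K_pow.
move=> G_pre [U [GU univU]].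
exists ((fun y => (slice k0 y, slice k1 y)) @^-1` U); split.
  by apply: (G_pre _ _ _ _ _ GU); apply: pair_continuous.
rewrite univU => _ [y _ <-].
exists (fun x => join (fun i => if i == k0 then y else x)).
  apply: (agree_continuous k0) => a; exists a => x x' xx'.
  by apply: join_agree => i; case: eqP.
apply/seteqP; split=> x; rewrite /preimage /= !joinK eqxx gt_eqF //.
  by move=> /xsectionP.
by move=> Uyx; apply/xsectionP.
Qed.

End Universal.

(** * Transfer along an embedding *)

Section Embedding.
Variables (Y X : topologicalType) (f : Y -> X).
Hypothesis f_emb : is_embedding Y X f.

Lemma embedding_initial : initial_map f.
Proof.
have [f_inj _ f_open] := f_emb; move=> A /f_open[V V_open fA].
exists V => //; apply/seteqP; split=> y.
  by move=> Ay; have [] : (V `&` range f) (f y) by rewrite -fA; exists y.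
move=> Vfy; have [y' Ay' /f_inj <- //] : (f @` A) (f y).
by rewrite fA; split=> //; exists y.
Qed.

(** The open set of X * Z is the largest one whose preimage lies in the given
    set; the product of the traces of two factors of a box is one candidate. *)
Lemma embedding_prod_initial (Z : topologicalType) :
  initial_map (fun yz : Y * Z => (f yz.1, yz.2)).
Proof.
move=> A A_open.
pose g (yz : Y * Z) := (f yz.1, yz.2).
exists (\bigcup_(V in [set V | open V /\ g @^-1` V `<=` A]) V).
  by apply: bigcup_open => V [].
apply/seteqP; split=> [[y z] Ayz|yz [V [_ VA] Vyz]]; last exact: VA.
have [[N M] /= [Ny Mz] NMA] : nbhs (y, z) A by exact: open_nbhs_nbhs.
move: Ny Mz; rewrite !nbhsE => -[N' [N'_open N'y] N'N] [M' [M'_open M'z] M'M].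
have [V V_open N'V] := embedding_initial N'_open.
exists (V `*` M'); last by split=> //=; suff: (f @^-1` V) y by []; rewrite -N'V.
split=> [|[y' z'] [/= Vfy' M'z']]; first exact: open_setX.
by apply: NMA; split; [apply: N'N; rewrite N'V|exact: M'M].
Qed.

Lemma universal_embedding G : preimage_closed G -> trace_closed G ->
  (exists U, is_universal G Y X U) -> exists U, is_universal G X X U.
Proof.
move=> G_pre G_trace [U [GU univU]].
have [V GV UV] := G_trace _ _ _ _ (@embedding_prod_initial X) GU.
exists V; split=> //; apply/seteqP; split=> [A|_ [x _ <-]]; last first.
  exact: (xsection_preimage_closed x G_pre GV).
rewrite univU => -[y _ <-]; exists (f y) => //.
by rewrite UV !xsectionE.
Qed.

End Embedding.

Lemma complete_embedding d (K : orderType d) (X : topologicalType) f G :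
    is_embedding (gcantor K) X f -> trace_closed G ->
  (exists A, is_complete K G (gcantor K) A) -> exists A, is_complete K G X A.
Proof.
move=> f_emb G_trace [A [GA A_complete]].
have [V GV AV] := G_trace _ _ _ _ (embedding_initial f_emb) GA.
exists V; split=> // B /A_complete[g g_cont ->].
exists (f \o g); last by rewrite AV.
have [_ f_cont _] := f_emb.
by move=> x; apply: continuous_comp; [exact: g_cont|exact: f_cont].
Qed.

Theorem proposition4p7 (d : Order.disp_t) (K : orderType d)
    (X : topologicalType)
    (K_card : is_cardinal K) (K_uncountable : ~ countable [set: K])
    (K_pow : pow_lt_eq K)
    (X_nonempty : [set: X] !=set0) (X_regular : regular_space X)
    (X_hausdorff : hausdorff_space X) (X_weight : weight_le X K) :
  [/\ (forall (e : Order.disp_t) (O : orderType e) (a : O),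
         is_well_order O -> ge1 a -> lt_succ_card K a ->
         [/\ exists U, is_universal (KSigma K a) (gcantor K) X U,
             exists U, is_universal (KPi K a) (gcantor K) X U,
             exists A, is_complete K (KSigma K a) (gcantor K) A,
             exists A, is_complete K (KPi K a) (gcantor K) A &
             ~ exists U, is_universal (KDelta K a) (gcantor K) (gcantor K) U]),
      ~ (exists U, is_universal (KBor K) (gcantor K) (gcantor K) U) &
      (exists f : gcantor K -> X, is_embedding (gcantor K) X f) ->
        (forall (e : Order.disp_t) (O : orderType e) (a : O),
           is_well_order O -> ge1 a -> lt_succ_card K a ->
           [/\ exists U, is_universal (KSigma K a) X X U,
               exists U, is_universal (KPi K a) X X U,
               exists A, is_complete K (KSigma K a) X A,
               exists A, is_complete K (KPi K a) X A &
               ~ exists U, is_universal (KDelta K a) X X U]) /\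
        ~ (exists U, is_universal (KBor K) X X U)].
Proof.
have {}K_pow : [set: Defs.bseq K] #<= [set: K].
  by move: K_pow; rewrite /pow_lt_eq card_eq_le => /andP[].
have [k0 _] := uncountable_point K_uncountable.
have C_weight : weight_le (gcantor K) K := gcantor_weight k0 K_pow.
have sigma Z e (O : orderType e) (a : O) : weight_le Z K -> is_well_order O ->
    ge1 a -> lt_succ_card K a ->
    exists U, is_universal (KSigma K a) (gcantor K) Z U.
  by move=> ? ? ? ?; exact: universal_KSigma.
have pi Z e (O : orderType e) (a : O) : weight_le Z K -> is_well_order O ->
    ge1 a -> lt_succ_card K a ->
    exists U, is_universal (KPi K a) (gcantor K) Z U.
  move=> Z_weight O_wo a1 aK; have [U univU] := sigma Z e O a Z_weight O_wo a1 aK.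
  by exists (~` U); exact: universal_setC.
have complete := complete_of_universal K_card K_uncountable K_pow.
split=> [e O a O_wo a1 aK||[f f_emb]].
- split; [exact: sigma|exact: pi| | |].
  + by apply: complete; [exact: KSigma_preimage|exact: sigma].
  + by apply: complete; [exact: KPi_preimage|exact: pi].
  + by apply: no_self_universal; [exact: KDelta_preimage|exact: KDelta_setC].
- by apply: no_self_universal; [exact: KBor_preimage|exact: KBor_setC].
- split; last first.
    by apply: no_self_universal; [exact: KBor_preimage|exact: KBor_setC].
  move=> e O a O_wo a1 aK.
  have S_pre := KSigma_preimage (K := K) O_wo (a := a).
  have P_pre := KPi_preimage (K := K) O_wo (a := a).
  have S_trace := KSigma_trace (K := K) O_wo (a := a).
  have P_trace := KPi_trace (K := K) O_wo (a := a).
  split.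
  + by apply: (universal_embedding f_emb S_pre S_trace); exact: sigma.
  + by apply: (universal_embedding f_emb P_pre P_trace); exact: pi.
  + by apply: (complete_embedding f_emb S_trace); apply: complete => //; exact: sigma.
  + by apply: (complete_embedding f_emb P_trace); apply: complete => //; exact: pi.
  + by apply: no_self_universal; [exact: KDelta_preimage|exact: KDelta_setC].
Qed.
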